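(* Fix $m\ge1$ and $i_1,\dots,i_m\in\{1,\dots,n\}$, and put $\tilde F:=x_kx^k$, $\tilde Y:=x_k\gamma^k$. Then in $Z_n'$, \begin{align*} \widehat{x^{i_1}}\cdots\widehat{x^{i_m}}&=(H+1)\cdots(H+m)\,x^{i_1}\cdots x^{i_m}\\ &\quad+\sum_{q=1}^{m}\frac{\prod_{k=q+1}^{m}(H+k)}{2^q}\,\tilde F^{q-1}\Big(\tilde Y\sum_{t=0}^{q-1}[\eta^tx^{m-q-t}\gamma\,\partial^{q-1-t};i_1,\dots,i_m]+\tilde F\sum_{t=0}^{q}[\eta^tx^{m-q-t}\partial^{q-t};i_1,\dots,i_m]\Big)+I', \end{align*} i.e. the product of the classes $\widehat{x^{i_k}}$ equals the class modulo $I'$ of the displayed element of $\mathcal{A}'$.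
   Context: Fix $n\ge1$ and an invertible complex matrix $\eta=(\eta^{ij})$ with $\eta^{ij}=\eta^{ji}$ and inverse $(\eta_{ij})$. $\mathcal{A}=W(2n|n)$ is the associative superalgebra generated by even $x^1,\dots,x^n,\partial_1,\dots,\partial_n$ and odd $\gamma^1,\dots,\gamma^n$ with relations $x^ix^j=x^jx^i$, $\partial_i\partial_j=\partial_j\partial_i$, $\partial_ix^j-x^j\partial_i=\delta_i^j$, $\gamma^i$ commuting with all $x^j,\partial_j$, $\gamma^i\gamma^j+\gamma^j\gamma^i=2\eta^{ij}$. Repeated indices are summed; $x_i=\eta_{ij}x^j$, $\partial^i=\eta^{ij}\partial_j$. $X=\frac{\sqrt{-1}}{\sqrt2}\gamma^i\partial_i$, $H=-\frac12(\partial_ix^i+x^i\partial_i)$, $E=-\frac12\partial^i\partial_i$. $\mathcal{A}'$ is the localization of $\mathcal{A}$ at the multiplicative set generated by $\{H+k:k\in\mathbb{Z}\}$, $I'=\mathcal{A}'X+\mathcal{A}'E$, $N_{\mathcal{A}'}(I')=\{a\in\mathcal{A}':I'a\subset I'\}$, and $Z_n'=N_{\mathcal{A}'}(I')/I'$ (localized reduction algebra). For each $i$, $\widehat{x^i}\in Z_n'$ denotes the class modulo $I'$ of $(H+1)x^i+\frac12\gamma^jx_j\gamma^i+\frac12x^jx_j\partial^i$ (which lies in $N_{\mathcal{A}'}(I')$). Bracket symbol: for integers $a,q,t\ge0$ and $p$ with $2a+p+q+t=m$, $[\eta^ax^p\gamma^q\partial^t;i_1,\dots,i_m]:=0$ if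 $p<0$, and otherwise $:=\frac1{2^aa!p!t!}\sum_{\sigma\in S_m}\prod_{l=0}^{a-1}\eta^{i_{\sigma(2l+1)}i_{\sigma(2l+2)}}\,x^{i_{\sigma(2a+1)}}\cdots x^{i_{\sigma(2a+p)}}\,\gamma^{i_{\sigma(2a+p+1)}}\cdots\gamma^{i_{\sigma(2a+p+q)}}\,\partial^{i_{\sigma(2a+p+q+1)}}\cdots\partial^{i_{\sigma(m)}}$ (factors with exponent $0$ omitted). *)

(* Defs.v *)
From mathcomp Require Import all_boot all_order all_algebra all_fingroup.
From mathcomp Require Import reals.
From mathcomp Require Import complex.
Set Implicit Arguments. Unset Strict Implicit. Unset Printing Implicit Defensive.
Import Order.TTheory GRing.Theory Num.Theory.
Local Open Scope ring_scope.

Section WeylClifford.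
Variables (R : realType) (n : nat).
Local Notation C := (R[i]).
(* eta = (eta^{ij}) (upper indices); invmx eta = (eta_{ij}) (lower indices). *)
Variable eta : 'M[C]_n.
Variable A : unitAlgType C.
(* x i = x^i, d i = partial_i, g i = gamma^i. *)
Variables (x d g : 'I_n -> A).

Definition WC_relations : Prop :=
  [/\ (forall i j, x i * x j = x j * x i),
      (forall i j, d i * d j = d j * d i),
      (forall i j, d i * x j - x j * d i = (i == j)%:R),
      (forall i j, g i * x j = x j * g i) &
      (forall i j, g i * d j = d j * g i) ]
  /\ (forall i j, g i * g j + g j * g i = (2 * eta i j)%:A).

Definition xlow (i : 'I_n) : A := \sum_j (invmx eta i j) *: x j.
Definition dup (i : 'I_n) : A := \sum_j (eta i j) *: d j.

Definition Xop : A := ('i / sqrtC 2) *: \sum_i g i * d i.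
Definition Hop : A := (- 2%:R^-1 : C) *: \sum_i (d i * x i + x i * d i).
Definition Eop : A := (- 2%:R^-1 : C) *: \sum_i dup i * d i.

(* Every H + k (k integer) is invertible: A plays the role of the localization. *)
Definition H_shifts_invertible : Prop := forall k : int, (Hop + k%:~R) \is a GRing.unit.

Definition in_Iprime (z : A) : Prop := exists a b : A, z = a * Xop + b * Eop.

Definition xhat (i : 'I_n) : A :=
  (Hop + 1) * x i + (2%:R^-1 : C) *: ((\sum_j g j * xlow j) * g i)
                  + (2%:R^-1 : C) *: ((\sum_j x j * xlow j) * dup i).

Definition Ftilde : A := \sum_k xlow k * x k.
Definition Ytilde : A := \sum_k xlow k * g k.

Fixpoint eta_pairs (a : nat) (s : seq 'I_n) : C :=
  match a, s with
  | a'.+1, i :: j :: r => eta i j * eta_pairs a' r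
  | _, _ => 1
  end.

(* The bracket symbol [eta^a x^p gamma^q partial^t ; i_1, ..., i_m]
   (indices are 0-based: idx k = i_{k+1}).  Zero when p < 0. *)
Definition bracket (m : nat) (a : nat) (p : int) (q t : nat) (idx : 'I_m -> 'I_n) : A :=
  match p with
  | Negz _ => 0
  | Posz p' =>
    ((2 ^ a * a`! * p'`! * t`!)%N%:R^-1 : C) *:
      \sum_(s : 'S_m)
        let l := [seq idx (s k) | k <- enum 'I_m] in
        eta_pairs a l *:
          ((\prod_(i <- take p' (drop (2 * a) l)) x i)
           * (\prod_(i <- take q (drop (2 * a + p') l)) g i)
           * (\prod_(i <- drop (2 * a + p' + q) l) dup i))
  end.

Definition thm54_rhs (m : nat) (idx : 'I_m -> 'I_n) : A :=
  (\prod_(1 <= k < m.+1) (Hop + k%:R)) * (\prod_(k < m) x (idx k))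
  + \sum_(1 <= q < m.+1)
      ((\prod_(q.+1 <= k < m.+1) (Hop + k%:R))
       * (((2 ^ q)%N%:R^-1 : C) *:
          (Ftilde ^+ q.-1
           * (Ytilde * (\sum_(0 <= t < q)
                          bracket t (m%:Z - q%:Z - t%:Z) 1 (q.-1 - t) idx)
              + Ftilde * (\sum_(0 <= t < q.+1)
                          bracket t (m%:Z - q%:Z - t%:Z) 0 (q - t) idx))))).

End WeylClifford.

(* Main.v *)
(* The identity holds exactly in A, not only modulo I'.  Write xhat^i = (H+1) x^i + (Y g^i + F d^i)/2,
   where Y^2 = F, and let B_q and G_q be the two inner sums over t of the right-hand side, without
   and with a gamma.  Then B_q is the coefficient of s^q in the ordered product of the
   x^(i_k) + s d^(i_k), and G_q is the coefficient of s^(q-1) in the sum of the products obtained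
   by replacing one factor with g^(i_k).  Hence, when an index i is prepended,
     B'_q = x^i B_q + d^i B_(q-1),    G'_q = x^i G_q + g^i B_(q-1) + d^i G_(q-1).
   For T_q(G, B) = F^(q-1) Y G + F^q B one has
     (Y g^i + F d^i) T_q(G, B) = 2q T_q(x^i G, x^i B) + T_(q+1)(g^i B + d^i G, d^i B),
   and moving x^i, Y g^i or F d^i past H shifts H by 1; induct on m. *)
Require Import Defs.
From mathcomp Require Import all_boot all_order all_algebra all_fingroup.
From mathcomp Require Import reals.
From mathcomp Require Import complex.
From mathcomp Require Import zify.
Import Order.TTheory GRing.Theory Num.Theory.
Local Open Scope ring_scope.

(** * Symmetrization over permutations *)

Section SeqInsertion.
Context {T : Type}.
Implicit Types (i c : T) (l : seq T).

Definition seq_insert j i l := take j l ++ i :: drop j l.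
Definition seq_delete j l := take j l ++ drop j.+1 l.

Lemma size_seq_insert j i l : size (seq_insert j i l) = (size l).+1.
Proof. by rewrite size_cat /= addnS -size_cat cat_take_drop. Qed.

Lemma nth_seq_insert i0 j i l : (j <= size l)%N -> nth i0 (seq_insert j i l) j = i.
Proof.
by move=> jl; rewrite nth_cat size_takel // ltnn subnn.
Qed.

(** [bump j] skips position [j], as [lift] does on ordinals; this ties insertion to [lift_perm]. *)
Lemma nth_seq_insert_bump i0 j i l k : (j <= size l)%N ->
  nth i0 (seq_insert j i l) (bump j k) = nth i0 l k.
Proof.
move=> jl; rewrite nth_cat size_takel // /bump.
case: (leqP j k) => jk.
  by rewrite add1n ltnNge leqW //= subSn //= nth_drop subnKC.
by rewrite add0n jk nth_take.
Qed.

Lemma seq_insertK i j l : (j <= size l)%N -> seq_delete j (seq_insert j i l) = l.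
Proof.
move=> jl; rewrite /seq_delete /seq_insert take_size_cat ?size_takel //.
by rewrite -cat_rcons drop_size_cat ?cat_take_drop // size_rcons size_takel.
Qed.

Lemma drop_insert_lt k j i l : (j <= k)%N -> (j <= size l)%N ->
  drop k.+1 (seq_insert j i l) = drop k l.
Proof.
move=> jk jl; rewrite /seq_insert -cat_rcons drop_cat size_rcons size_takel //.
rewrite ltnS ltnNge jk /= subSS drop_drop; congr drop; lia.
Qed.

Lemma drop_insert_ge k j i l : (k <= j <= size l)%N ->
  drop k (seq_insert j i l) = seq_insert (j - k) i (drop k l).
Proof.
move=> /andP[kj jl]; rewrite /seq_insert drop_cat size_takel // drop_drop subnK //.
rewrite take_drop subnK //.
case: ltnP => // jk; have -> : k = j by lia.
by rewrite subnn /= [drop j (take j l)]drop_oversize // size_takel.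
Qed.

Lemma take_insert_ge k j i l : (k <= j <= size l)%N ->
  take k (seq_insert j i l) = take k l.
Proof.
move=> /andP[kj jl]; rewrite /seq_insert take_cat size_takel //.
case: ltnP => jk; first by rewrite take_takel // ltnW.
have -> : k = j by lia.
by rewrite subnn take0 cats0.
Qed.

Lemma take_insert_lt k j i l : (j <= k)%N -> (j <= size l)%N ->
  take k.+1 (seq_insert j i l) = seq_insert j i (take k l).
Proof.
move=> jk jl; rewrite /seq_insert take_cat size_takel // ltnNge leqW //=.
rewrite subSn //= take_takel // take_drop.
by rewrite subnK.
Qed.

End SeqInsertion.

(** * Sums over all rearrangements of an index family *)

Section PermutationSums.
Context {T : Type} {V : nmodType}.
Implicit Types f : seq T -> V.

Lemma size_map_enum_ord m (h : 'I_m -> T) : size [seq h k | k <- enum 'I_m] = m.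
Proof. by rewrite size_map size_enum_ord. Qed.

Lemma nth_map_enum_ord i0 m (h : 'I_m -> T) (k : 'I_m) :
  nth i0 [seq h k | k <- enum 'I_m] k = h k.
Proof. by rewrite (nth_map k) ?size_enum_ord // nth_ord_enum. Qed.

Lemma map_lift_perm m (h : 'I_m.+1 -> T) (j i : 'I_m.+1) (s : 'S_m) :
  [seq h (lift_perm j i s k) | k <- enum 'I_m.+1]
    = seq_insert j (h i) [seq h (lift i (s k)) | k <- enum 'I_m].
Proof.
have jl : (j <= size [seq h (lift i (s k)) | k <- enum 'I_m])%N.
  by rewrite size_map_enum_ord -ltnS.
apply: (@eq_from_nth _ (h i)).
  by rewrite size_seq_insert !size_map_enum_ord.
move=> k; rewrite size_map_enum_ord => km.
rewrite -[k]/(val (Ordinal km)) nth_map_enum_ord.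
case: (unliftP j (Ordinal km)) => [k'|] ->.
  by rewrite lift_perm_lift /= nth_seq_insert_bump // nth_map_enum_ord.
by rewrite lift_perm_id nth_seq_insert.
Qed.

Definition perm_sum {m} (idx : 'I_m -> T) f : V :=
  \sum_(s : 'S_m) f [seq idx (s k) | k <- enum 'I_m].

(** Injectivity recovers [j] as the preimage of [i]; counting, [(m+1) * m! = (m+1)!], does the
    rest. *)
Lemma lift_perm_bij m (i : 'I_m.+1) :
  bijective (fun js : 'I_m.+1 * 'S_m => lift_perm js.1 i js.2).
Proof.
apply: inj_card_bij.
  move=> [j s] [j' s'] /= e.
  have ej : j = j'.
    apply: (@perm_inj _ (lift_perm j i s)).
    by rewrite lift_perm_id e lift_perm_id.
  subst j'; congr (_, _); apply/permP => k.
  by apply: (@lift_inj _ i); rewrite -(lift_perm_lift j) e lift_perm_lift.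
by rewrite card_prod card_ord !card_Sn factS.
Qed.

(** Permutations are sorted by the position [j] at which the first index lands. *)
Lemma perm_sum_recl m (idx : 'I_m.+1 -> T) f :
  perm_sum idx f = \sum_(j < m.+1)
     perm_sum (fun k => idx (lift ord0 k)) (fun l => f (seq_insert j (idx ord0) l)).
Proof.
rewrite /perm_sum (reindex _ (onW_bij _ (lift_perm_bij m ord0))) /=.
rewrite pair_big /=; apply: eq_bigr => -[j s] _ /=.
by rewrite map_lift_perm.
Qed.

(** Moving the head letter to position [r] composes with a fixed permutation, which only reindexes
    the sum. The default [0] is never reached, as the words are nonempty. *)
Lemma perm_sum_insert m (idx : 'I_m.+1 -> T) f r : (r <= m)%N ->
  perm_sum idx f
  = perm_sum idx (fun l => if l is c :: l' then f (seq_insert r c l') else 0).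
Proof.
move=> rm; have [j jr] : exists j : 'I_m.+1, r = j by exists (Ordinal (rm : r < m.+1)%N).
rewrite /perm_sum (reindex_inj (mulgI (lift_perm j ord0 1%g))) /=.
apply: eq_bigr => s _.
transitivity (f [seq idx (s (lift_perm j ord0 1%g k)) | k <- enum 'I_m.+1]).
  by congr f; apply: eq_map => k; rewrite /= permM.
rewrite (map_lift_perm _ (fun k => idx (s k))) [in RHS]enum_ordSl /= -map_comp jr.
by congr (f (seq_insert _ _ _)); apply: eq_map => k /=; rewrite perm1.
Qed.

Lemma eq_perm_sum m (idx : 'I_m -> T) f f' :
  (forall l, size l = m -> f l = f' l) -> perm_sum idx f = perm_sum idx f'.
Proof.
move=> ff'; apply: eq_bigr => s _; apply: ff'.
by rewrite size_map_enum_ord.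
Qed.

End PermutationSums.

(** * Products of commuting factors and normalizing scalars *)

Lemma mulr_prod_comm (B : pzRingType) (I : Type) (u : B) (F : I -> B) (s : seq I) :
  (forall k, u * F k = F k * u) -> u * \prod_(k <- s) F k = (\prod_(k <- s) F k) * u.
Proof.
move=> uF; elim: s => [|k s IHs]; first by rewrite big_nil mulr1 mul1r.
by rewrite big_cons mulrA uF -mulrA IHs mulrA.
Qed.

Lemma prod_seq_insert (B : pzRingType) (I : Type) (F : I -> B) j i (s : seq I) :
  (forall k l, F k * F l = F l * F k) ->
  \prod_(k <- seq_insert j i s) F k = F i * \prod_(k <- s) F k.
Proof.
move=> FC; rewrite big_cat big_cons /= mulrA -mulr_prod_comm // -mulrA.
by rewrite -big_cat cat_take_drop.
Qed.

Lemma perm_sum_mull (T : Type) (B : pzRingType) m (idx : 'I_m -> T) (f : seq T -> B) u :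
  u * perm_sum idx f = perm_sum idx (fun l => u * f l).
Proof. by rewrite /perm_sum big_distrr. Qed.

Lemma perm_sum_mulr (T : Type) (B : pzRingType) m (idx : 'I_m -> T) (f : seq T -> B) u :
  perm_sum idx f * u = perm_sum idx (fun l => f l * u).
Proof. by rewrite /perm_sum big_distrl. Qed.

(** Used to cancel the number [k] of equal terms against one factor of a normalizing constant, such
    as [p] in [p!]. *)
Lemma scale_invn_mulrn (F : numFieldType) (V : lmodType F) (k N N' : nat) (v : V) :
  (0 < k)%N -> N' = (N * k)%N -> (N'%:R^-1 : F) *: (v *+ k) = (N%:R^-1 : F) *: v.
Proof.
move=> k_gt0 ->; rewrite -scaler_nat scalerA natrM invfM -mulrA mulVf ?mulr1 //.
by rewrite pnatr_eq0 -lt0n.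
Qed.

(** * Recursion for the brackets *)

Section WeylClifford.
Context {R : realType} {n : nat} (eta : 'M[R[i]]_n) {A : unitAlgType R[i]}.
Context (x d g : 'I_n -> A).
Hypotheses (eta_sym : eta^T = eta) (rels : WC_relations eta x d g).
Local Notation C := R[i].
Local Notation dup := (dup eta d).
Local Notation bracket := (bracket eta x d g).

(** * Commutation relations with raised derivatives *)

Lemma etaC i j : eta i j = eta j i.
Proof. by rewrite -{1}eta_sym mxE. Qed.

Lemma mulxx i j : x i * x j = x j * x i.
Proof. by case: rels => -[]. Qed.

Lemma mulgx i j : g i * x j = x j * g i.
Proof. by case: rels => -[]. Qed.

Lemma mulgd i j : g i * d j = d j * g i.
Proof. by case: rels => -[]. Qed.

Lemma muldd i j : d i * d j = d j * d i.
Proof. by case: rels => -[]. Qed.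

Lemma muldx i j : d i * x j = x j * d i + (i == j)%:R.
Proof. by case: rels => -[_ _ <- _ _] _; rewrite addrC subrK. Qed.

Lemma mulgg i j : g i * g j + g j * g i = (2 * eta i j)%:A.
Proof. by case: rels. Qed.

Lemma mul_dup_x i j : dup i * x j = x j * dup i + (eta i j)%:A.
Proof.
rewrite /Defs.dup big_distrl big_distrr /=.
rewrite (eq_bigr (fun k => x j * (eta i k *: d k) + eta i k *: (k == j)%:R)); last first.
  by move=> k _; rewrite -scalerAl muldx scalerDr scalerAr.
rewrite big_split /=; congr (_ + _).
rewrite (bigD1 j) //= eqxx big1 ?addr0 // => k /negPf ->.
by rewrite scaler0.
Qed.

Lemma mul_dup_dup i j : dup i * dup j = dup j * dup i.
Proof.
rewrite /Defs.dup !big_distrl /=.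
under eq_bigr do rewrite big_distrr /=.
rewrite exchange_big /=; apply: eq_bigr => k _; rewrite big_distrr /=.
apply: eq_bigr => l _; rewrite -!scalerAl -!scalerAr !scalerA mulrC.
by rewrite muldd.
Qed.

Lemma mul_g_dup i j : g i * dup j = dup j * g i.
Proof.
rewrite /Defs.dup big_distrl big_distrr /=; apply: eq_bigr => k _.
by rewrite -scalerAl -scalerAr mulgd.
Qed.

Lemma eta_pairs_take a l : eta_pairs eta a (take (2 * a) l) = eta_pairs eta a l.
Proof.
elim: a l => [|a IHa] l //.
by rewrite mulnS add2n; case: l => [|i [|j l]] //=; rewrite IHa.
Qed.

(** [j./2.*2] is the start of the pair containing position [j]. Depending on the parity of [j], the
    new pair reads [i, c] or [c, i], which agree by symmetry of [eta]; the other pairs stay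
    aligned. *)
Lemma eta_pairs_insert2 a j i c l : (j < 2 * a.+1)%N -> (2 * a <= size l)%N ->
  eta_pairs eta a.+1 (seq_insert j i (seq_insert j./2.*2 c l)) = eta i c * eta_pairs eta a l.
Proof.
elim: a j l => [|a IHa] j l ja al.
  by case: j ja => [|[|//]] _; case: l {al} => [|? ?]; rewrite /= ?take0 /= ?mulr1 // etaC.
case: j ja => [|[|j]] ja; first by case: l {al}.
  by case: l {al} => [|? ?] /=; rewrite etaC.
rewrite mulnS add2n in al; case: l al => [|u [|v l]] //= al.
change (eta u v * eta_pairs eta a.+1 (seq_insert j i (seq_insert j./2.*2 c l))
        = eta i c * (eta u v * eta_pairs eta a l)).
rewrite IHa; [by rewrite mulrCA | lia | lia].
Qed.

(** One unnormalized summand of a bracket. The derivative degree is implicit: the last product takes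
    all remaining letters. *)
Definition word a p q (l : seq 'I_n) : A :=
  eta_pairs eta a l *: ((\prod_(k <- take p (drop (2 * a) l)) x k)
   * (\prod_(k <- take q (drop (2 * a + p) l)) g k)
   * (\prod_(k <- drop (2 * a + p + q) l) dup k)).

(* A pairing of i with another index arises in two ways: when i falls among the eta factors, and
   when d^i is commuted past the x factors. *)
Definition contraction i a p q {m} (idx : 'I_m -> 'I_n) : A :=
  perm_sum idx (fun l => if l is c :: l' then eta i c *: word a p q l' else 0).

(** After symmetrization, the position [r] of the partner of [i] does not matter, so all
    contractions of one kind are equal. *)
Lemma contractionE r m i a p q (idx : 'I_m -> 'I_n) (f : seq 'I_n -> A) :
  (r < m)%N ->
  (forall c l, size l = m.-1 -> f (seq_insert r c l) = eta i c *: word a p q l) ->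
  perm_sum idx f = contraction i a p q idx.
Proof.
case: m idx => // m idx rm fE; rewrite (@perm_sum_insert _ _ m idx f r rm).
by apply: eq_perm_sum => -[|c l] //= [/fE].
Qed.

Lemma word_insert_eta a p q i j c l : (j < 2 * a.+1)%N -> (2 * a <= size l)%N ->
  word a.+1 p q (seq_insert j i (seq_insert j./2.*2 c l)) = eta i c *: word a p q l.
Proof.
move=> ja al; have sz := size_seq_insert j./2.*2 c l.
rewrite /word eta_pairs_insert2 // scalerA mulnS !addSn add0n.
by rewrite !drop_insert_lt ?sz //; lia.
Qed.

Lemma word_insert_x a p q i j l : (2 * a <= j <= 2 * a + p)%N -> (2 * a + p <= size l)%N ->
  word a p.+1 q (seq_insert j i l) = x i * word a p q l.
Proof.
move=> ja al; rewrite /word -(eta_pairs_take a (seq_insert _ _ _)).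
rewrite take_insert_ge ?eta_pairs_take; last lia.
rewrite drop_insert_ge; last lia.
rewrite take_insert_lt ?size_drop; try lia.
rewrite prod_seq_insert; last exact: mulxx.
rewrite !addnS !addSn !drop_insert_lt; try lia.
by rewrite -scalerAr !mulrA.
Qed.

(** Gammas do not commute with each other, so only a block with a single gamma is treated; that
    gamma moves left past the [x] factors. *)
Lemma word_insert_g a p i l : (2 * a + p <= size l)%N ->
  word a p 1 (seq_insert (2 * a + p) i l) = g i * word a p 0 l.
Proof.
move=> al; rewrite /word -(eta_pairs_take a (seq_insert _ _ _)).
rewrite take_insert_ge ?eta_pairs_take; last lia.
rewrite addn1 drop_insert_lt // !drop_insert_ge; try lia.
rewrite subnn take_insert_ge; last by rewrite size_drop; lia.
rewrite take_insert_lt // !take0 /seq_insert /= big_seq1 big_nil mulr1 addn0.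
by rewrite -scalerAr mulrA -mulr_prod_comm // => k; rewrite mulgx.
Qed.

Lemma word_insert_d a p q i j l : (2 * a + p + q <= j <= size l)%N ->
  word a p q (seq_insert j i l) = word a p q l * dup i.
Proof.
move=> ja; rewrite /word -(eta_pairs_take a (seq_insert _ _ _)).
rewrite take_insert_ge ?eta_pairs_take; last lia.
rewrite !drop_insert_ge; try lia.
rewrite !take_insert_ge ?size_drop; try lia.
rewrite prod_seq_insert; last exact: mul_dup_dup.
by rewrite mulr_prod_comm ?mulrA -?scalerAl // => k; exact: mul_dup_dup.
Qed.

(** The first index lands in a block of length [2a], [p], [q] or [t], and all positions in a block
    contribute equally. The predecessors are harmless at [0], where the multiplicity vanishes. *)
Lemma perm_sum_word_recl m (idx : 'I_m.+1 -> 'I_n) a p q t :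
  (q <= 1)%N -> (2 * a + p + q + t = m.+1)%N ->
  let i := idx ord0 in let idx' k := idx (lift ord0 k) in
  perm_sum idx (word a p q) =
    contraction i a.-1 p q idx' *+ (2 * a) + x i * perm_sum idx' (word a p.-1 q) *+ p
    + g i * perm_sum idx' (word a p 0) *+ q + perm_sum idx' (word a p q) * dup i *+ t.
Proof.
move=> q1 sz i idx'; rewrite perm_sum_recl -/i -/idx' -(big_mkord xpredT (fun j =>
   perm_sum idx' (fun l => word a p q (seq_insert j i l)))).
rewrite (@big_cat_nat _ _ _ (2 * a + p + q)) /=; [|lia..].
rewrite (@big_cat_nat _ _ _ (2 * a + p) _ (2 * a + p + q)) /=; [|lia..].
rewrite (@big_cat_nat _ _ _ (2 * a) _ (2 * a + p)) /=; [|lia..].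
have const u v k z (F : nat -> A) : (v - u)%N = k ->
    (forall j, (u <= j < v)%N -> F j = z) -> \sum_(u <= j < v) F j = z *+ k.
  by move=> <- Fz; rewrite -sumr_const_nat; apply: eq_big_nat.
congr (_ + _ + _ + _).
- apply: const; first lia.
  case: a sz => [|a] sz j ja; first lia.
  (* Once [i] is removed, its partner sits at the even position [j./2.*2], whichever slot of the
     pair [i] held. *)
  apply: (@contractionE j./2.*2); first lia.
  by move=> c l sl; apply: word_insert_eta; lia.
- apply: const; first lia.
  case: p sz => [|p] sz j ja; first lia.
  rewrite perm_sum_mull; apply: eq_perm_sum => l sl.
  by apply: word_insert_x; lia.
- apply: const; first lia.
  case: q q1 sz => [|[|//]] _ sz j ja; first lia.
  have -> : j = (2 * a + p)%N by lia.
  rewrite perm_sum_mull; apply: eq_perm_sum => l sl.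
  by apply: word_insert_g; lia.
apply: const; first lia.
move=> j ja; rewrite perm_sum_mulr; apply: eq_perm_sum => l sl.
by apply: word_insert_d; lia.
Qed.

(** Leibniz rule. *)
Lemma mul_dup_prod_x i s : dup i * \prod_(k <- s) x k
  = (\prod_(k <- s) x k) * dup i
    + \sum_(r < size s) eta i (nth i s r) *: \prod_(k <- seq_delete r s) x k.
Proof.
elim: s => [|c s IHs]; first by rewrite big_nil big_ord0 addr0 mul1r mulr1.
rewrite big_cons mulrA mul_dup_x mulrDl -mulrA IHs mulrDr mulrA -addrA; congr (_ + _).
rewrite big_ord_recl /= addrC; congr (_ + _); first by rewrite mulr_algl /seq_delete /= drop0.
rewrite big_distrr /=; apply: eq_bigr => r _.
by rewrite -scalerAr /seq_delete /= big_cons.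
Qed.

(** [dup i] commutes with gammas and derivatives, so it contracts only with the [p] factors [x],
    each time with the same symmetrized result. *)
Lemma mul_dup_perm_sum m i (idx : 'I_m -> 'I_n) a p q t : (2 * a + p + q + t = m)%N ->
  dup i * perm_sum idx (word a p q)
  = perm_sum idx (word a p q) * dup i + contraction i a p.-1 q idx *+ p.
Proof.
move=> sz; pose X (l : seq 'I_n) := take p (drop (2 * a) l).
pose f r (l : seq 'I_n) := eta i (nth i (X l) r) *: (eta_pairs eta a l *:
  (\prod_(k <- seq_delete r (X l)) x k
   * (\prod_(k <- take q (drop (2 * a + p) l)) g k)
   * (\prod_(k <- drop (2 * a + p + q) l) dup k))).
transitivity (perm_sum idx (fun l => word a p q l * dup i + \sum_(r < p) f r l)).
  rewrite perm_sum_mull; apply: eq_perm_sum => l sl.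
  rewrite /word -scalerAr !mulrA mul_dup_prod_x !mulrDl scalerDr; congr (_ + _).
    rewrite -scalerAl -!mulrA; congr (_ *: (_ * _)).
    have -> s : \prod_(k <- s) dup k * dup i = dup i * \prod_(k <- s) dup k.
      by rewrite mulr_prod_comm // => k; exact: mul_dup_dup.
    by rewrite !mulrA (mulr_prod_comm _ _ (dup i) g) // => k; rewrite mul_g_dup.
  rewrite size_takel ?size_drop; last lia.
  rewrite !big_distrl scaler_sumr /=; apply: eq_bigr => r _.
  by rewrite /f -!scalerAl !scalerA mulrC.
rewrite /perm_sum big_split /= -big_distrl /= exchange_big /=; congr (_ + _).
rewrite (eq_bigr (fun=> contraction i a p.-1 q idx)); first by rewrite sumr_const card_ord.
case: p sz @X @f => [|p] sz X f r _; first by case: r.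
have rp := ltn_ord r.
(* The [r]-th [x] factor is the letter at position [2 * a + r], after the eta pairs. *)
apply: (@contractionE (2 * a + r)); first lia.
move=> c l sl; rewrite /f /X /word /=; set e := eta_pairs _ _ (seq_insert _ _ _).
have -> : e = eta_pairs eta a l.
  rewrite /e -(eta_pairs_take a (seq_insert _ _ _)) take_insert_ge ?eta_pairs_take //; lia.
rewrite drop_insert_ge; last lia.
rewrite addKn take_insert_lt ?size_drop; try lia.
rewrite nth_seq_insert ?seq_insertK ?size_takel ?size_drop; try lia.
by rewrite !addnS !addSn !drop_insert_lt //; lia.
Qed.

(** * Normalized brackets and their recursion *)

Definition bracket_norm a p t := (2 ^ a * a`! * p`! * t`!)%N.

Lemma bracketE m a (p : nat) q t (idx : 'I_m -> 'I_n) :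
  bracket a p q t idx = (bracket_norm a p t)%:R^-1 *: perm_sum idx (word a p q).
Proof. by []. Qed.

Definition bracket_contraction {m} i a (p : int) q t (idx : 'I_m -> 'I_n) : A :=
  if p is Posz p' then (bracket_norm a p' t)%:R^-1 *: contraction i a p' q idx else 0.

Lemma mul_dup_bracket m i (idx : 'I_m -> 'I_n) a (p : int) q t :
  (2 * a)%:Z + p + q%:Z + t%:Z = m%:Z ->
  dup i * bracket a p q t idx
  = bracket a p q t idx * dup i + bracket_contraction i a (p - 1) q t idx.
Proof.
case: p => [p|p] sz; last by rewrite /= mulr0 mul0r addr0.
rewrite !bracketE -scalerAr (@mul_dup_perm_sum _ _ _ _ _ _ t); last lia.
rewrite scalerDr -scalerAl; congr (_ + _).
case: p sz => [|p] sz; first by rewrite scaler0.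
have -> : Posz p.+1 - 1 = p :> int by lia.
by rewrite (@scale_invn_mulrn _ _ _ (bracket_norm a p t)) //= /bracket_norm factS; lia.
Qed.

(** The multiplicities [2a], [p], [t] each cancel one factor of the normalization. The derivative is
    then moved from the right end to the left, which costs the subtracted contraction. *)
Lemma bracket_recl m (idx : 'I_m.+1 -> 'I_n) a (p : int) q t :
  (q <= 1)%N -> (2 * a)%:Z + p + q%:Z + t%:Z = m.+1%:Z ->
  let i := idx ord0 in let idx' k := idx (lift ord0 k) in
  bracket a p q t idx = x i * bracket a (p - 1) q t idx'
    + (g i * bracket a p 0 t idx') *+ q
    + (if t is t'.+1 then
         dup i * bracket a p q t' idx' - bracket_contraction i a (p - 1) q t' idx'
       else 0)
    + (if a is a'.+1 then bracket_contraction i a' p q t idx' else 0).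
Proof.
case: p => [p|p] q1 sz i idx'; last first.
  have -> : Negz p - 1 = Negz p.+1 by lia.
  by case: t a {sz} => [|t] [|a]; rewrite /= !mulr0 mul0rn ?subrr !addr0.
rewrite bracketE (@perm_sum_word_recl _ _ _ _ _ t) //; last lia.
rewrite -/i -/idx' !scalerDr [RHS]addrC -!addrA; congr (_ + _).
  case: a sz => [|a] sz; first by rewrite muln0 mulr0n scaler0.
  by rewrite (@scale_invn_mulrn _ _ _ (bracket_norm a p t)) //= /bracket_norm factS expnS; lia.
congr (_ + _).
  case: p sz => [|p] sz; first by rewrite mulr0n scaler0 mulr0.
  have -> : Posz p.+1 - 1 = p :> int by lia.
  rewrite bracketE -scalerAr.
  by rewrite (@scale_invn_mulrn _ _ _ (bracket_norm a p t)) //= /bracket_norm factS; lia.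
congr (_ + _); first by rewrite -scalerAr scalerMnr.
case: t sz => [|t] sz; first by rewrite mulr0n scaler0.
rewrite mul_dup_bracket; last lia.
rewrite addrK bracketE -scalerAl.
by rewrite (@scale_invn_mulrn _ _ _ (bracket_norm a p t)) //= /bracket_norm factS; lia.
Qed.

(* Written with d^i on the left, the recursion of each bracket has a contraction term for a and
   another for a - 1; they telescope in the sum over a. *)
Lemma bracket_sum_recl m (idx : 'I_m.+1 -> 'I_n) (M : int) q e :
  (e <= 1)%N -> M + e%:Z = m%:Z ->
  let i := idx ord0 in let idx' k := idx (lift ord0 k) in
  \sum_(0 <= a < q.+1) bracket a (M + 1 - q%:Z - a%:Z) e (q - a) idx
  = x i * (\sum_(0 <= a < q.+1) bracket a (M - q%:Z - a%:Z) e (q - a) idx')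
    + (g i * \sum_(0 <= a < q.+1) bracket a (M + 1 - q%:Z - a%:Z) 0 (q - a) idx') *+ e
    + dup i * \sum_(0 <= a < q) bracket a (M + 1 - q%:Z - a%:Z) e (q.-1 - a) idx'.
Proof.
move=> e1 Mm i idx'.
rewrite (eq_big_nat _ _ (fun a (aq : (0 <= a < q.+1)%N) =>
  @bracket_recl m idx a (M + 1 - q%:Z - a%:Z) e (q - a) e1 ltac:(lia))).
rewrite -/i -/idx' !big_split /= -addrA !big_distrr /= sumrMnl; congr (_ + _ + _).
  by apply: eq_bigr => a _; congr (_ * bracket _ _ _ _ _); lia.
(* There is no derivative at [a = q] and no eta pair at [a = 0]; dropping these ends aligns the two
   contraction sums with a shift by one. *)
rewrite [X in X + _]big_nat_recr //= subnn addr0 [X in _ + X]big_nat_recl //= add0r.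
rewrite -big_split; apply: eq_big_nat => a aq /=.
have -> : (q - a = (q.-1 - a).+1)%N by lia.
rewrite addrAC -addrA -[RHS]addr0; congr (_ + _); apply/eqP; rewrite subr_eq0; apply/eqP.
by congr bracket_contraction; lia.
Qed.

(** * The inner sums of the right-hand side *)

Definition bracket_sum m q (idx : 'I_m -> 'I_n) : A :=
  \sum_(0 <= t < q.+1) bracket t (m%:Z - q%:Z - t%:Z) 0 (q - t) idx.

Definition bracket_gsum m q (idx : 'I_m -> 'I_n) : A :=
  \sum_(0 <= t < q) bracket t (m%:Z - q%:Z - t%:Z) 1 (q.-1 - t) idx.

Lemma bracket_gsum0 m (idx : 'I_m -> 'I_n) : bracket_gsum _ 0 idx = 0.
Proof. exact: big_geq. Qed.

Lemma bracket_sum0 m (idx : 'I_m.+1 -> 'I_n) :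
  bracket_sum _ 0 idx = x (idx ord0) * bracket_sum _ 0 (fun k => idx (lift ord0 k)).
Proof.
have := @bracket_sum_recl m idx m%:Z 0 0 isT (addr0 _); cbv zeta.
rewrite mulr0n /bracket_sum => e; etransitivity; last first.
  etransitivity; first exact: e.
  by rewrite [\sum_(0 <= a < 0) _]big_geq // mulr0 -addrA !addr0.
by apply: eq_bigr => a _; congr bracket; lia.
Qed.

Lemma bracket_sumS m (idx : 'I_m.+1 -> 'I_n) q :
  let i := idx ord0 in let idx' k := idx (lift ord0 k) in
  bracket_sum _ q.+1 idx = x i * bracket_sum _ q.+1 idx' + dup i * bracket_sum _ q idx'.
Proof.
have := @bracket_sum_recl m idx m%:Z q.+1 0 isT (addr0 _); cbv zeta.
rewrite mulr0n /bracket_sum => e; etransitivity; last first.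
  etransitivity; first exact: e.
  by rewrite addr0; congr (_ + _ * _); apply: eq_bigr => a _; congr bracket; lia.
by apply: eq_bigr => a _; congr bracket; lia.
Qed.

Lemma bracket_gsumS m (idx : 'I_m.+1 -> 'I_n) q :
  let i := idx ord0 in let idx' k := idx (lift ord0 k) in
  bracket_gsum _ q.+1 idx = x i * bracket_gsum _ q.+1 idx'
    + (g i * bracket_sum _ q idx' + dup i * bracket_gsum _ q idx').
Proof.
(* The gamma uses up one index, hence [m%:Z - 1]. *)
have := @bracket_sum_recl m idx (m%:Z - 1) q 1 isT (subrK _ _); cbv zeta.
rewrite mulr1n /bracket_sum /bracket_gsum addrA => e; etransitivity; last first.
  etransitivity; first exact: e.
  by congr (_ * _ + _ * _ + _ * _); apply: eq_bigr => a _; congr bracket; lia.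
by apply: eq_bigr => a _; congr bracket; lia.
Qed.

(** Every exponent of [x] is negative here, so each bracket is zero by convention. *)
Lemma bracket_sum_oversize m (idx : 'I_m -> 'I_n) : bracket_sum _ m.+1 idx = 0.
Proof.
by apply: big1 => a _; have -> : m%:Z - m.+1%:Z - a%:Z = Negz a by lia.
Qed.

Lemma bracket_gsum_oversize m (idx : 'I_m -> 'I_n) : bracket_gsum _ m.+1 idx = 0.
Proof.
by apply: big1 => a _; have -> : m%:Z - m.+1%:Z - a%:Z = Negz a by lia.
Qed.

Lemma bracket_sum0_prod m (idx : 'I_m -> 'I_n) :
  bracket_sum _ 0 idx = \prod_(k < m) x (idx k).
Proof.
elim: m idx => [|m IHm] idx; last by rewrite bracket_sum0 IHm big_ord_recl.
rewrite /bracket_sum big_nat1 big_ord0 /= (big_pred1 1%g); last first.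
  by move=> s; apply/esym/eqP/permP => -[].
rewrite enum_ord0 /= !big_nil !mulr1 !scale1r !fact0 expn0 !muln1.
by rewrite invr1 scale1r.
Qed.
(** * Multiplication by xhat *)

Hypothesis eta_inv : eta \in unitmx.
Local Notation xlow := (xlow eta x).
Local Notation H := (Hop x d).
Local Notation F := (Ftilde eta x).
Local Notation Y := (Ytilde eta x g).
Local Notation xhat := (xhat eta x d g).

(** * Commutation relations of [Y] and [F] with the generators *)

Lemma mul_xlow_x i j : xlow i * x j = x j * xlow i.
Proof.
rewrite /Defs.xlow big_distrl big_distrr /=; apply: eq_bigr => k _.
by rewrite -scalerAl -scalerAr mulxx.
Qed.

Lemma mul_g_xlow i j : g i * xlow j = xlow j * g i.
Proof.
rewrite /Defs.xlow big_distrl big_distrr /=; apply: eq_bigr => k _.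
by rewrite -scalerAl -scalerAr mulgx.
Qed.

Lemma mul_dup_xlow i j : dup i * xlow j = xlow j * dup i + (i == j)%:R.
Proof.
rewrite /Defs.xlow big_distrr big_distrl /=.
under eq_bigr do rewrite -scalerAr mul_dup_x scalerDr scalerAl.
rewrite big_split /=; congr (_ + _).
under eq_bigr do rewrite scalerA etaC.
rewrite -scaler_suml; have := congr1 (fun M : 'M_n => M j i) (mulVmx eta_inv).
by rewrite !mxE eq_sym => ->; case: (i == j); rewrite ?scale1r ?scale0r.
Qed.

Lemma sum_eta_xlow i : \sum_k eta i k *: xlow k = x i.
Proof.
rewrite /Defs.xlow; under eq_bigr do rewrite scaler_sumr.
rewrite exchange_big /=.
have sumE j : \sum_k eta i k *: (invmx eta k j *: x j) = (i == j)%:R *: x j.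
  have := congr1 (fun M : 'M_n => M i j) (mulmxV eta_inv).
  by rewrite !mxE => <-; rewrite scaler_suml; apply: eq_bigr => k _; rewrite scalerA.
under eq_bigr do rewrite sumE.
rewrite (bigD1 i) //= eqxx scale1r big1 ?addr0 // => j.
by rewrite eq_sym => /negPf ->; rewrite scale0r.
Qed.

Lemma mul_Y_x i : Y * x i = x i * Y.
Proof.
rewrite /Ytilde big_distrl big_distrr /=; apply: eq_bigr => k _.
by rewrite -mulrA mulgx !mulrA mul_xlow_x.
Qed.

Lemma mul_xlow_xlow i j : xlow i * xlow j = xlow j * xlow i.
Proof.
rewrite [xlow j]/Defs.xlow big_distrr big_distrl /=; apply: eq_bigr => k _.
by rewrite -scalerAl -scalerAr mul_xlow_x.
Qed.

Lemma mul_Y_xlow i : Y * xlow i = xlow i * Y.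
Proof.
rewrite /Ytilde big_distrl big_distrr /=; apply: eq_bigr => k _.
by rewrite -mulrA mul_g_xlow !mulrA mul_xlow_xlow.
Qed.

Lemma mul_F_x i : F * x i = x i * F.
Proof.
rewrite /Ftilde big_distrl big_distrr /=; apply: eq_bigr => k _.
by rewrite -mulrA mulxx !mulrA mul_xlow_x.
Qed.

Lemma mul_g_F i : g i * F = F * g i.
Proof.
rewrite /Ftilde big_distrr big_distrl /=; apply: eq_bigr => k _.
by rewrite mulrA mul_g_xlow -!mulrA mulgx.
Qed.

Lemma mul_Y_F : Y * F = F * Y.
Proof.
rewrite /Ftilde big_distrr big_distrl /=; apply: eq_bigr => k _.
by rewrite mulrA mul_Y_xlow -!mulrA mul_Y_x.
Qed.

(** The Clifford relation gives [2 * eta i k] against [xlow k], and [eta] raises the index back. *)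
Lemma mul_g_Y i : g i * Y = x i *+ 2 - Y * g i.
Proof.
apply/eqP; rewrite eq_sym subr_eq eq_sym; apply/eqP.
rewrite /Ytilde big_distrr big_distrl /= -big_split /= -sum_eta_xlow -sumrMnl.
apply: eq_bigr => k _; rewrite mulrA mul_g_xlow -!mulrA -mulrDr mulgg.
by rewrite mulr_algr -[RHS]scaler_nat scalerA.
Qed.

(** Expanding the left factor in one copy of [Y * Y] and the right factor in another makes the
    anticommutator of [g k] and [Y] appear, so twice [Y * Y] is twice [F]. *)
Lemma mul_Y_Y : Y * Y = F.
Proof.
have double_inj (u v : A) : u *+ 2 = v *+ 2 -> u = v.
  have nz2 : (2%:R : C) != 0 by rewrite pnatr_eq0.
  by move=> e; apply: (scalerI nz2); rewrite !scaler_nat.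
have YYl : Y * Y = \sum_k xlow k * (g k * Y).
  by rewrite {1}/Ytilde mulr_suml; apply: eq_bigr => k _; rewrite mulrA.
have YYr : Y * Y = \sum_k xlow k * (Y * g k).
  by rewrite {2}/Ytilde mulr_sumr; apply: eq_bigr => k _; rewrite mulrA mul_Y_xlow mulrA.
apply: double_inj; rewrite mulr2n {1}YYl YYr -big_split /=.
rewrite /Ftilde -sumrMnl; apply: eq_bigr => k _.
by rewrite -mulrDr mul_g_Y subrK mulrnAr.
Qed.

Lemma mul_dup_Y i : dup i * Y = Y * dup i + g i.
Proof.
rewrite /Ytilde big_distrr big_distrl /=.
under eq_bigr do rewrite mulrA mul_dup_xlow mulrDl -mulrA -mul_g_dup mulrA.
rewrite big_split /=; congr (_ + _).
rewrite (bigD1 i) //= eqxx mul1r big1 ?addr0 // => k.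
by rewrite eq_sym => /negPf ->; rewrite mul0r.
Qed.

Lemma mul_dup_F i : dup i * F = F * dup i + x i *+ 2.
Proof.
rewrite /Ftilde big_distrr big_distrl /=.
under eq_bigr do rewrite mulrA mul_dup_xlow mulrDl -mulrA mul_dup_x mulrDr mulr_algr mulrA -addrA.
rewrite big_split /=; congr (_ + _).
rewrite big_split /= sum_eta_xlow mulr2n; congr (_ + _).
rewrite (bigD1 i) //= eqxx mul1r big1 ?addr0 // => k.
by rewrite eq_sym => /negPf ->; rewrite mul0r.
Qed.

Lemma mul_dup_F_expn i k : dup i * F ^+ k = F ^+ k * dup i + (F ^+ k.-1 * x i) *+ (2 * k).
Proof.
elim: k => [|k IHk]; first by rewrite muln0 mulr0n addr0 expr0 mulr1 mul1r.
rewrite exprSr mulrA IHk mulrDl -mulrA mul_dup_F mulrDr mulrA -addrA; congr (_ + _).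
rewrite mulrnAl -mulrA -mul_F_x mulrA mulrnAr mulnS [RHS]mulrnDr; congr (_ + _).
case: k {IHk} => [|k]; first by rewrite muln0.
by rewrite -exprSr.
Qed.

(* At q = 0 the first summand is spurious (0.-1 = 0); it is only ever used there with G = 0. *)
Definition rhs_term q (G B : A) := F ^+ q.-1 * (Y * G) + F ^+ q * B.

Lemma mul_F_expn_comm u k : u * F = F * u -> u * F ^+ k = F ^+ k * u.
Proof. by move=> uF; apply: (commrX k uF). Qed.

Lemma mul_x_rhs_term i q G B : x i * rhs_term q G B = rhs_term q (x i * G) (x i * B).
Proof.
have xF k : x i * F ^+ k = F ^+ k * x i by apply: mul_F_expn_comm; rewrite mul_F_x.
by rewrite /rhs_term mulrDr !mulrA !xF -!mulrA [x i * (Y * _)]mulrA -mul_Y_x -mulrA.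
Qed.

(** For [q > 0], differentiating the powers of [F] gives [2(q-1)] on the [G] part and [2q] on the
    [B] part; anticommuting [g i] with [Y] supplies the missing [2]. *)
Lemma rhs_term_step i q G B : (q = 0%N -> G = 0) ->
  (Y * g i + F * dup i) * rhs_term q G B
  = rhs_term q (x i * G) (x i * B) *+ (2 * q) + rhs_term q.+1 (g i * B + dup i * G) (dup i * B).
Proof.
have gF k : g i * F ^+ k = F ^+ k * g i by apply: mul_F_expn_comm; rewrite mul_g_F.
have YF k : Y * F ^+ k = F ^+ k * Y by apply: mul_F_expn_comm; rewrite mul_Y_F.
rewrite /rhs_term; case: q => [/(_ erefl) ->|q _].
  by rewrite !mulr0 addr0 add0r muln0 mulr0n !add0r !expr0 !mul1r mulrDl -!mulrA.
rewrite [q.+1.-1]/= [q.+2.-1]/=.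
have YgG : Y * g i * (F ^+ q * (Y * G)) = (F ^+ q * (Y * (x i * G))) *+ 2 - F ^+ q.+1 * (g i * G).
  rewrite -mulrA [g i * _]mulrA gF -mulrA [Y * _]mulrA YF -mulrA.
  rewrite [g i * (Y * G)]mulrA mul_g_Y mulrBl mulrBr mulrBr mulrnAl !mulrnAr.
  by rewrite -!mulrA [Y * (Y * _)]mulrA mul_Y_Y exprSr -!mulrA.
have YgB : Y * g i * (F ^+ q.+1 * B) = F ^+ q.+1 * (Y * (g i * B)).
  by rewrite -mulrA [g i * _]mulrA gF -mulrA [Y * _]mulrA YF -mulrA.
have FdG : F * dup i * (F ^+ q * (Y * G))
    = F ^+ q.+1 * (Y * (dup i * G)) + F ^+ q.+1 * (g i * G)
      + (F ^+ q * (Y * (x i * G))) *+ (2 * q).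
  rewrite -mulrA [dup i * _]mulrA mul_dup_F_expn mulrDl mulrDr; congr (_ + _).
    rewrite -mulrA [dup i * _]mulrA mul_dup_Y mulrDl !mulrDr !mulrA -exprS.
    by [].
  (* [F * F ^+ q.-1] is [F ^+ q] only for positive [q]; at [0] the multiplicity vanishes. *)
  rewrite mulrnAl mulrnAr; case: q {YgG YgB} => [|q]; first by rewrite muln0 !mulr0n.
  congr (_ *+ _).
  by rewrite !mulrA -exprS -!mulrA [x i * (Y * _)]mulrA -mul_Y_x -mulrA.
have FdB : F * dup i * (F ^+ q.+1 * B)
    = F ^+ q.+2 * (dup i * B) + (F ^+ q.+1 * (x i * B)) *+ (2 * q.+1).
  rewrite -mulrA [dup i * _]mulrA mul_dup_F_expn mulrDl mulrDr; congr (_ + _).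
    by rewrite !mulrA -exprS.
  by rewrite mulrnAl mulrnAr !mulrA -exprS.
rewrite mulrDl !mulrDr YgG YgB FdG FdB mulrnDl.
rewrite [in X in _ = X + _ + _]mulnS [in X in _ = X + _ + _]mulrnDr.
(* The last group pairs the two opposite terms in [g i * G], which cancel. *)
by rewrite [LHS](AC (3*(3*2)) ((1*6*8)*(3*4*7)*(2*5)))/= addNr addr0.
Qed.

(** * Degree with respect to [H] *)

Definition shifts_H (u : A) (s : int) := u * H = (H + s%:~R) * u.

(** The sum is [-2 H], so its commutator [2s] becomes a shift by [s]. *)
Lemma shifts_H_of (u : A) (s : int) :
  (\sum_i (d i * x i + x i * d i)) * u = u * (\sum_i (d i * x i + x i * d i)) + u *~ (2 * s) ->
  shifts_H u s.
Proof.
move=> e; rewrite /shifts_H mulrDl /Hop -scalerAl -scalerAr e scalerDr -addrA.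
rewrite -[LHS]addr0; congr (_ + _).
have -> : u *~ (2 * s) = 2%:R *: (u *~ s) by rewrite mulrC mulrzA scaler_nat.
by rewrite scalerA mulNr mulVf ?pnatr_eq0 // scaleN1r mulrzl addNr.
Qed.

Lemma shifts_H_x i : shifts_H (x i) 1.
Proof.
apply: shifts_H_of; rewrite mulr_suml mulr_sumr.
(* Each of the two products contributes one delta term, hence the factor 2. *)
rewrite (eq_bigr (fun j => x i * (d j * x j + x j * d j) + (j == i)%:R * x j *+ 2)).
  rewrite big_split /=; congr (_ + _).
  rewrite (bigD1 i) //= eqxx big1 ?addr0 ?mul1r // => j /negPf ->.
  by rewrite mul0r mul0rn.
move=> j _; rewrite mulrDl -!mulrA muldx mulxx [d j * (x i * x j)]mulrA muldx.
rewrite mulrDl !mulrDr -!mulrA [x j * (x i * d j)]mulrA [x j * x i]mulxx -!mulrA.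
rewrite mulr2n -!addrA; congr (_ + _); rewrite addrCA; congr (_ + (_ + _)).
by case: (j == i); rewrite ?mulr1 ?mul1r ?mulr0 ?mul0r.
Qed.

Lemma shifts_H_d i : shifts_H (d i) (-1).
Proof.
apply: shifts_H_of; rewrite mulr_suml mulr_sumr.
rewrite (eq_bigr (fun j => d i * (d j * x j + x j * d j) - (i == j)%:R * d j *+ 2)).
  rewrite big_split /= sumrN; congr (_ + _).
  rewrite (bigD1 i) //= eqxx big1 ?addr0 ?mul1r // => j.
  by rewrite eq_sym => /negPf ->; rewrite mul0r mul0rn.
move=> j _; have xd : x j * d i = d i * x j - (i == j)%:R by rewrite muldx addrK.
rewrite mulrDl -!mulrA xd muldd [x j * (d i * d j)]mulrA xd.
rewrite mulrBl mulrBr mulrDr -!mulrA [d j * (d i * x j)]mulrA [d j * d i]muldd -!mulrA.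
rewrite mulr2n opprD -!addrA; congr (_ + _); rewrite addrCA; congr (_ + _).
by case: (i == j); rewrite ?mulr1 ?mul1r ?mulr0 ?mul0r ?oppr0 ?addr0.
Qed.

Lemma shifts_H_g i : shifts_H (g i) 0.
Proof.
apply: shifts_H_of; rewrite mulr0 mulr0z addr0 mulr_suml mulr_sumr.
apply: eq_bigr => j _; rewrite mulrDl mulrDr -!mulrA -mulgx -mulgd !mulrA.
by rewrite -mulgx -mulgd.
Qed.

Lemma shifts_H_scale c u s : shifts_H u s -> shifts_H (c *: u) s.
Proof. by rewrite /shifts_H => us; rewrite -[LHS]scalerAl us scalerAr. Qed.

Lemma shifts_H_mul u v s t : shifts_H u s -> shifts_H v t -> shifts_H (u * v) (s + t).
Proof.
rewrite /shifts_H => us vt; rewrite -mulrA vt mulrA mulrDr us commr_int.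
by rewrite -mulrDl -addrA -intrD mulrA.
Qed.

Lemma shifts_H_sum (I : finType) (u : I -> A) s :
  (forall i, shifts_H (u i) s) -> shifts_H (\sum_i u i) s.
Proof.
by rewrite /shifts_H mulr_suml mulr_sumr => us; apply: eq_bigr => i _; exact: us.
Qed.

Lemma shifts_H_dup i : shifts_H (dup i) (-1).
Proof. by apply: shifts_H_sum => j; apply: shifts_H_scale; apply: shifts_H_d. Qed.

Lemma shifts_H_xlow i : shifts_H (xlow i) 1.
Proof. by apply: shifts_H_sum => j; apply: shifts_H_scale; apply: shifts_H_x. Qed.

Lemma shifts_H_F : shifts_H F 2.
Proof.
apply: shifts_H_sum => j.
exact: shifts_H_mul (shifts_H_xlow j) (shifts_H_x j).
Qed.

Lemma shifts_H_Y : shifts_H Y 1.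
Proof.
apply: shifts_H_sum => j.
exact: shifts_H_mul (shifts_H_xlow j) (shifts_H_g j).
Qed.

(** * Shifted products in [H] and the induction on [m] *)

Definition H_prod a b : A := \prod_(a <= k < b) (H + k%:R).

Lemma mul_H_prod u a b : shifts_H u 1 -> u * H_prod a b = H_prod a.+1 b.+1 * u.
Proof.
rewrite /H_prod big_add1 /= => uH; elim: (index_iota a b) => [|k s IHs].
  by rewrite !big_nil mulr1 mul1r.
rewrite !big_cons mulrA mulrDr uH mulr_natr -mulr_natl -mulrDl -mulrA IHs mulrA.
by rewrite -addrA -natrD add1n.
Qed.

Lemma mul_H_prodC k a b : (H + k%:R) * H_prod a b = H_prod a b * (H + k%:R).
Proof.
rewrite /H_prod mulr_prod_comm // => l.
by rewrite !mulrDl !mulrDr (commr_nat H k) (commr_nat H l) -!natrM mulnC addrACA.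
Qed.

Lemma H_prod_recl a b : (a < b)%N -> H_prod a.+1 b * (H + a%:R) = H_prod a b.
Proof.
by move=> ab; rewrite -mul_H_prodC /H_prod [RHS]big_ltn.
Qed.

Lemma xhatE i : xhat i = (H + 1) * x i + 2%:R^-1 *: (Y * g i + F * dup i).
Proof.
rewrite /Defs.xhat scalerDr addrA; congr (_ + _ *: (_ * _) + _ *: (_ * _)).
  by apply: eq_bigr => k _; rewrite mul_g_xlow.
by apply: eq_bigr => k _; rewrite mul_xlow_x.
Qed.

(** The part [(H + 1) x^i] gives the factor [H + 1], and half of the multiplicity [2a] adds [a]. The
    resulting [H + (a+1)] is the factor missing from the shifted product. *)
Lemma xhat_step i a b G B : (a = 0%N -> G = 0) -> (a < b.+1)%N ->
  xhat i * (H_prod a.+1 b.+1 * ((2 ^ a)%:R^-1 *: rhs_term a G B))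
  = H_prod a.+1 b.+2 * ((2 ^ a)%:R^-1 *: rhs_term a (x i * G) (x i * B))
    + H_prod a.+2 b.+2
      * ((2 ^ a.+1)%:R^-1 *: rhs_term a.+1 (g i * B + dup i * G) (dup i * B)).
Proof.
move=> G0 ab; rewrite xhatE mulrDl.
have shY : shifts_H (Y * g i + F * dup i) 1.
  rewrite /shifts_H mulrDl mulrDr; congr (_ + _).
    exact: shifts_H_mul shifts_H_Y (shifts_H_g i).
  exact: shifts_H_mul shifts_H_F (shifts_H_dup i).
set c := _^-1; set T1 := rhs_term a (x i * G) _; set T2 := rhs_term a.+1 _ _.
set P := H_prod a.+1 b.+1; set P' := H_prod a.+2 b.+2.
have -> : (H + 1) * x i * (P * (c *: rhs_term a G B)) = P' * ((H + 1) * (c *: T1)).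
  rewrite mulrA -(mulrA (H + 1)) (mul_H_prod _ _ _ (shifts_H_x i)) !mulrA.
  by rewrite (mul_H_prodC 1) -!mulrA -scalerAr mul_x_rhs_term.
have -> : 2%:R^-1 *: (Y * g i + F * dup i) * (P * (c *: rhs_term a G B))
    = P' * (2%:R^-1 *: (c *: (T1 *+ (2 * a) + T2))).
  rewrite -[LHS]scalerAl -[RHS]scalerAr; congr (_ *: _).
  by rewrite mulrA (mul_H_prod _ _ _ shY) -mulrA -[X in _ * X]scalerAr rhs_term_step.
have -> : 2%:R^-1 *: (c *: (T1 *+ (2 * a) + T2))
    = a%:R * (c *: T1) + ((2 ^ a.+1)%:R^-1 *: T2).
  rewrite 2!scalerDr !scalerA; congr (_ + _ *: _); last first.
    by rewrite expnS natrM invfM.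
  rewrite mulr_natl -[T1 *+ _]scaler_nat scalerA -[RHS]scaler_nat scalerA; congr (_ *: _).
  by rewrite natrM mulrAC mulrA mulVf ?pnatr_eq0 // mul1r.
rewrite -(H_prod_recl a.+1 b.+2) // -/P' -mulrA -!mulrDr addrA -mulrDl -addrA.
by rewrite nat1r.
Qed.

(** The separate leading term is the case [q = 0], where the gamma sum is empty and the other sum is
    the product of the [x]. *)
Lemma thm54_rhsE m (idx : 'I_m -> 'I_n) :
  thm54_rhs eta x d g idx = \sum_(0 <= q < m.+1)
    H_prod q.+1 m.+1 * ((2 ^ q)%:R^-1 *: rhs_term q (bracket_gsum m q idx) (bracket_sum m q idx)).
Proof.
rewrite big_nat_recl // /thm54_rhs; congr (_ + _).
  rewrite expn0 invr1 scale1r /rhs_term bracket_sum0_prod bracket_gsum0.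
  by rewrite !mulr0 add0r expr0 mul1r.
rewrite big_add1; apply: eq_bigr => q _; congr (_ * (_ *: _)).
by rewrite mulrDr /rhs_term /= exprSr -!mulrA.
Qed.

Lemma rhs_termD q G G' B B' : rhs_term q (G + G') (B + B') = rhs_term q G B + rhs_term q G' B'.
Proof. by rewrite /rhs_term !mulrDr addrACA. Qed.

Lemma rhs_term0 q : rhs_term q 0 0 = 0.
Proof. by rewrite /rhs_term !mulr0 addr0. Qed.

Lemma prod_xhat m (idx : 'I_m -> 'I_n) :
  \prod_(k < m) xhat (idx k) = thm54_rhs eta x d g idx.
Proof.
elim: m idx => [|m IHm] idx; first by rewrite big_ord0 /thm54_rhs !big_geq // big_ord0 mulr1 addr0.
rewrite big_ord_recl IHm !thm54_rhsE big_distrr /=.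
pose i := idx ord0; pose idx' k := idx (lift ord0 k).
pose G q := bracket_gsum m q idx'; pose B q := bracket_sum m q idx'.
pose c q : C := (2 ^ q)%:R^-1.
have G0 q : q = 0%N -> G q = 0 by move=> ->; exact: bracket_gsum0.
rewrite (eq_big_nat _ _ (fun q (qm : (0 <= q < m.+1)%N) =>
  xhat_step i q m (G q) (B q) (G0 q) (ltac:(lia) : (q < m.+1)%N))).
rewrite big_split /=.
(* The first sum gains the term [q = m.+1], which vanishes because [G] and [B] do; the second is
   reindexed by one, so that equal [q] can be combined by the bracket recursions. *)
transitivity (\sum_(0 <= q < m.+2) H_prod q.+1 m.+2 * (c q *: rhs_term q (x i * G q) (x i * B q))
  + \sum_(1 <= q < m.+2) H_prod q.+1 m.+2
      * (c q *: rhs_term q (g i * B q.-1 + dup i * G q.-1) (dup i * B q.-1))).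
  rewrite [in RHS]big_nat_recr //= /G /B bracket_gsum_oversize bracket_sum_oversize.
  by rewrite !mulr0 rhs_term0 scaler0 mulr0 addr0 big_add1.
rewrite [RHS]big_nat_recl // [X in X + _ = _]big_nat_recl // -addrA big_add1.
rewrite -big_split /=; congr (_ + _).
  by rewrite bracket_sum0 /G !bracket_gsum0 mulr0.
apply: eq_bigr => q _; rewrite -mulrDr -scalerDr -rhs_termD.
by rewrite bracket_gsumS bracket_sumS.
Qed.

End WeylClifford.

Theorem theorem5p4 (R : realType) (n : nat) (eta : 'M[R[i]]_n)
  (eta_sym : eta^T = eta) (eta_inv : eta \in unitmx)
  (A : unitAlgType R[i]) (x d g : 'I_n -> A)
  (rels : WC_relations eta x d g)
  (loc : H_shifts_invertible x d)
  (m : nat) (m_pos : (1 <= m)%N) (idx : 'I_m -> 'I_n) :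
  in_Iprime eta d g
    (\prod_(k < m) xhat eta x d g (idx k) - thm54_rhs eta x d g idx).
Proof.
(* The difference is zero in [A] itself, so both coefficients can be zero. *)
exists 0, 0; rewrite (prod_xhat eta x d g eta_sym rels eta_inv) subrr.
by rewrite !mul0r addr0.
Qed.
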